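(* Let $(\mathbb T,M,(-)^\circ,m)$ be an idealized monad on a category $\mathbf C$ with finite coproducts. Then: (1) $\mathbb T$ becomes an abstractly guarded monad when equipped with weak guardedness as the notion of abstract guardedness. (2) If $\mathbb T$ is completely iterative, then every weakly $\mathrm{inr}$-guarded morphism $f\colon X\to T(Y+X)$ has a unique solution, i.e. a unique $f^\dagger\colon X\to TY$ with $f^\dagger=[\eta,f^\dagger]^*\circ f$. (3) If $(\alpha,\beta)$ is an idealized monad morphism from $\mathbb T$ to another idealized monad, then $\alpha$ preserves weak guardedness: if $f\colon X\to TY$ is weakly $\sigma$-guarded then so is $\alpha_Y\circ f$.
   Context: $\mathbb T=(T,\eta,(-)^* )$ is a monad in Kleisli-triple form. A module over $\mathbb T$ is $(M,(-)^\circ)$ with $M$ a map on objects and $(-)^\circ\colon\mathrm{Hom}(X,TY)\to\mathrm{Hom}(MX,MY)$ satisfying $\eta^\circ=\mathrm{id}$ and $g^\circ\circ f^\circ=(g^*\circ f)^\circ$ (so $M$ is a functor via $Mf=(\eta f)^\circ$). A module-to-monad morphism is a natural $m\colon M\to T$ with $m\circ f^\circ=f^*\circ m$. An idealized monad is $(\mathbb T,M,(-)^\circ,m)$. An idealized monad morphism $(\alpha,\beta)$ from $(\mathbb T,M,(-)^\circ,m)$ to $(\mathbb S,N,(-)^\bullet,m')$ consists of a monad morphism $\alpha\colon T\to S$ and a natural $\beta\colon M\to N$ with $\alpha\circ m=m'\circ\beta$ and $\beta\circ f^\circ=(\alpha\circ f)^\bullet\circ\beta$. A morphism $f\colon X\to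 T(Y+Z)$ is guarded if it factors through $[\eta\circ\mathrm{inl},m]\colon Y+M(Y+Z)\to T(Y+Z)$; $\mathbb T$ is completely iterative if every guarded $f\colon X\to T(Y+X)$ has a unique solution. For a summand $\sigma\colon Z\triangleleft Y$ (a pair exhibiting $Y$ as coproduct, identified with its first injection) with complement $\bar\sigma\colon Y'\triangleleft Y$, $f\colon X\to TY$ is weakly $\sigma$-guarded if it factors through $[\eta\circ\bar\sigma,m_Y]^*\colon T(Y'+MY)\to TY$. A monad is abstractly guarded if it has a relation $f\colon X\to_\sigma TY$ closed under (trv) $T(\mathrm{inl})\circ f\colon X\to_{\mathrm{inr}}T(Y+Z)$ for all $f\colon X\to TY$; (par) $f\colon X\to_\sigma TZ$, $g\colon Y\to_\sigma TZ$ imply $[f,g]\colon X+Y\to_\sigma TZ$; (cmp) $f\colon X\to_{\mathrm{inr}}T(Y+Z)$, $g\colon Y\to_\sigma TV$, $h\colon Z\to TV$ imply $[g,h]^*\circ f\colon X\to_\sigma TV$. *)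

(* Defs.v *)
Set Implicit Arguments.
Unset Strict Implicit.
Unset Printing Implicit Defensive.

Declare Scope cat_scope.
Delimit Scope cat_scope with cat.
Open Scope cat_scope.

Record category := Category {
  obj :> Type;
  hom : obj -> obj -> Type;
  idm : forall X, hom X X;
  comp : forall X Y Z, hom Y Z -> hom X Y -> hom X Z;
  comp_idl : forall X Y (f : hom X Y), comp (idm Y) f = f;
  comp_idr : forall X Y (f : hom X Y), comp f (idm X) = f;
  compA : forall X Y Z W (h : hom Z W) (g : hom Y Z) (f : hom X Y),
    comp h (comp g f) = comp (comp h g) f }.

Arguments idm {c} X.

Notation "X ~> Y" := (hom X Y) (at level 90, no associativity) : cat_scope.
Notation "g ∘ f" := (comp g f) (at level 40, left associativity) : cat_scope.

Definition factors_through (C : category) (X Y Z : C)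
    (f : X ~> Z) (k : Y ~> Z) : Prop :=
  exists g : X ~> Y, f = k ∘ g.

Definition is_coproduct (C : category) (X Y S : C)
    (i : X ~> S) (j : Y ~> S) : Prop :=
  forall (W : C) (f : X ~> W) (g : Y ~> W),
    exists! h : S ~> W, h ∘ i = f /\ h ∘ j = g.

(* Finite coproducts are given by a chosen initial object and chosen binary
   coproducts. *)
Record coprodCategory := CoprodCategory {
  cat_of :> category;
  initial : cat_of;
  from_initial : forall X : cat_of, initial ~> X;
  from_initial_unique : forall (X : cat_of) (f : initial ~> X),
    f = from_initial X;
  coprod : cat_of -> cat_of -> cat_of;
  injl : forall X Y : cat_of, X ~> coprod X Y;
  injr : forall X Y : cat_of, Y ~> coprod X Y;
  copair : forall X Y Z : cat_of, (X ~> Z) -> (Y ~> Z) -> (coprod X Y ~> Z);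
  copair_injl : forall (X Y Z : cat_of) (f : X ~> Z) (g : Y ~> Z),
    copair f g ∘ injl X Y = f;
  copair_injr : forall (X Y Z : cat_of) (f : X ~> Z) (g : Y ~> Z),
    copair f g ∘ injr X Y = g;
  copair_unique : forall (X Y Z : cat_of) (f : X ~> Z) (g : Y ~> Z)
      (h : coprod X Y ~> Z),
    h ∘ injl X Y = f -> h ∘ injr X Y = g -> h = copair f g }.

Arguments injl {c} X Y.
Arguments injr {c} X Y.

Notation "X ⊕ Y" := (coprod X Y) (at level 50, left associativity) : cat_scope.
Notation "[| f , g |]" := (copair f g)
  (at level 0, f at level 99, g at level 99) : cat_scope.

(* [summand Z Y] is the type of summands sigma : Z <| Y. A complement need not
   be determined by the first injection, so a summand carries both. *)
Record summand (C : category) (Z Y : C) := Summand {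
  compl : C;
  summand_inj : Z ~> Y;
  compl_inj : compl ~> Y;
  summandP : is_coproduct summand_inj compl_inj }.

Lemma is_coproduct_inr (C : coprodCategory) (Y Z : C) :
  is_coproduct (injr Y Z) (injl Y Z).
Proof.
intros W f g; exists [| g, f |]; split.
- split; [apply copair_injr | apply copair_injl].
- intros h [hr hl]; symmetry; apply copair_unique; assumption.
Qed.

Definition inr_summand (C : coprodCategory) (Y Z : C) : summand Z (Y ⊕ Z) :=
  Summand (@is_coproduct_inr C Y Z).

Record monad (C : category) := Monad {
  mobj :> C -> C;
  eta : forall X, X ~> mobj X;
  kext : forall X Y, (X ~> mobj Y) -> (mobj X ~> mobj Y);
  kext_eta : forall X, kext (eta X) = idm (mobj X);
  kext_unit : forall X Y (f : X ~> mobj Y), kext f ∘ eta X = f;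
  kext_comp : forall X Y Z (g : Y ~> mobj Z) (f : X ~> mobj Y),
    kext g ∘ kext f = kext (kext g ∘ f) }.

Arguments eta {C} m X.

Definition monad_map (C : category) (T : monad C) (X Y : C) (f : X ~> Y) :
    T X ~> T Y :=
  kext (eta T Y ∘ f).

Record monad_module (C : category) (T : monad C) := MonadModule {
  modobj :> C -> C;
  mext : forall X Y, (X ~> T Y) -> (modobj X ~> modobj Y);
  mext_eta : forall X, mext (eta T X) = idm (modobj X);
  mext_comp : forall X Y Z (g : Y ~> T Z) (f : X ~> T Y),
    mext g ∘ mext f = mext (kext g ∘ f) }.

Arguments mext {C T} m [X Y] f.

Definition module_map (C : category) (T : monad C) (M : monad_module T)
    (X Y : C) (f : X ~> Y) : M X ~> M Y :=
  mext M (eta T Y ∘ f).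

Arguments module_map {C T} M [X Y] f.

Record idealized_monad (C : category) := IdealizedMonad {
  imonad :> monad C;
  imodule : monad_module imonad;
  imor : forall X, imodule X ~> imonad X;
  imor_nat : forall X Y (f : X ~> Y),
    imor Y ∘ module_map imodule f = monad_map imonad f ∘ imor X;
  imor_mext : forall X Y (f : X ~> imonad Y),
    imor Y ∘ mext imodule f = kext f ∘ imor X }.

Arguments imor {C} i X.

Record monad_morphism (C : category) (T S : monad C) := MonadMorphism {
  mmor :> forall X, T X ~> S X;
  mmor_nat : forall X Y (f : X ~> Y),
    mmor Y ∘ monad_map T f = monad_map S f ∘ mmor X;
  mmor_eta : forall X, mmor X ∘ eta T X = eta S X;
  mmor_kext : forall X Y (f : X ~> T Y),
    mmor Y ∘ kext f = kext (mmor Y ∘ f) ∘ mmor X }.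

Record idealized_morphism (C : category) (I J : idealized_monad C) :=
  IdealizedMorphism {
    ialpha : monad_morphism I J;
    ibeta : forall X, imodule I X ~> imodule J X;
    ibeta_nat : forall X Y (f : X ~> Y),
      ibeta Y ∘ module_map (imodule I) f = module_map (imodule J) f ∘ ibeta X;
    ialpha_imor : forall X, ialpha X ∘ imor I X = imor J X ∘ ibeta X;
    ibeta_mext : forall X Y (f : X ~> I Y),
      ibeta Y ∘ mext (imodule I) f = mext (imodule J) (ialpha Y ∘ f) ∘ ibeta X }.

Definition guarded (C : coprodCategory) (I : idealized_monad C) (X Y Z : C)
    (f : X ~> I (Y ⊕ Z)) : Prop :=
  factors_through f [| eta I (Y ⊕ Z) ∘ injl Y Z, imor I (Y ⊕ Z) |].

Definition is_solution (C : coprodCategory) (T : monad C) (X Y : C)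
    (f : X ~> T (Y ⊕ X)) (s : X ~> T Y) : Prop :=
  s = kext [| eta T Y, s |] ∘ f.

Definition completely_iterative (C : coprodCategory) (I : idealized_monad C) :
    Prop :=
  forall (X Y : C) (f : X ~> I (Y ⊕ X)),
    guarded f -> exists! s : X ~> I Y, is_solution f s.

Definition weakly_guarded (C : coprodCategory) (I : idealized_monad C)
    (X Y Z : C) (sigma : summand Z Y) (f : X ~> I Y) : Prop :=
  factors_through f (kext [| eta I Y ∘ compl_inj sigma, imor I Y |]).

Record abstract_guardedness (C : coprodCategory) (T : monad C)
    (G : forall X Y Z : C, summand Z Y -> (X ~> T Y) -> Prop) : Prop :=
  AbstractGuardedness {
    guarded_trv : forall (X Y Z : C) (f : X ~> T Y),
      G X (Y ⊕ Z) Z (inr_summand Y Z) (monad_map T (injl Y Z) ∘ f);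
    guarded_par : forall (X Y Z Z' : C) (sigma : summand Z' Z)
        (f : X ~> T Z) (g : Y ~> T Z),
      G X Z Z' sigma f -> G Y Z Z' sigma g ->
      G (X ⊕ Y) Z Z' sigma [| f, g |];
    guarded_cmp : forall (X Y Z V V' : C) (sigma : summand V' V)
        (f : X ~> T (Y ⊕ Z)) (g : Y ~> T V) (h : Z ~> T V),
      G X (Y ⊕ Z) Z (inr_summand Y Z) f -> G Y V V' sigma g ->
      G X V V' sigma (kext [| g, h |] ∘ f) }.

(* Main.v *)
(** Weakly guarded morphisms form a right ideal for Kleisli composition: if [k]
    is weakly guarded then so is [k^* ∘ f] for every [f].  The closure properties
    in (1) and (3) come down to exhibiting the morphism in question as
    [k^* ∘ f], where [k] is assembled by copairing from [eta] composed with the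
    complement injection, morphisms [m ∘ h], and given weakly guarded morphisms.

    For (2), a weakly guarded [f = [eta ∘ inl, m]^* ∘ g] is the composite of [g]
    and [m] in the Kleisli category of the exception monad [T(Y + -)].  The
    solutions of a composite of two such morphisms correspond bijectively to
    those of the composite in the opposite order, and that one is
    [[eta ∘ inl, g]^* ∘ m = m ∘ [eta ∘ inl, g]°], which is guarded. *)
Require Import Defs.

Set Implicit Arguments.
Unset Strict Implicit.
Unset Printing Implicit Defensive.

Lemma comp_copair (C : coprodCategory) (X Y Z W : C)
    (h : Z ~> W) (f : X ~> Z) (g : Y ~> Z) :
  h ∘ [| f, g |] = [| h ∘ f, h ∘ g |].
Proof.
apply copair_unique; rewrite <- compA.
- now rewrite copair_injl.
- now rewrite copair_injr.
Qed.

Section KleisliCopairing.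

Variables (C : coprodCategory) (T : monad C).

Lemma kext_eta_comp (X Y W : C) (f : X ~> T Y) (h : W ~> X) :
  kext f ∘ (eta T X ∘ h) = f ∘ h.
Proof. now rewrite compA, kext_unit. Qed.

Lemma kext_kext_copair (X Y Z V W : C) (k : Z ~> T V)
    (f : X ~> T Z) (g : Y ~> T Z) (h : W ~> T (X ⊕ Y)) :
  kext k ∘ (kext [| f, g |] ∘ h) = kext [| kext k ∘ f, kext k ∘ g |] ∘ h.
Proof. now rewrite compA, kext_comp, comp_copair. Qed.

Definition exception_kcomp (X Y Z W : C)
    (h : Z ~> T (Y ⊕ W)) (g : X ~> T (Y ⊕ Z)) : X ~> T (Y ⊕ W) :=
  kext [| eta T (Y ⊕ W) ∘ injl Y W, h |] ∘ g.

Lemma kext_exception_kcomp (X Y Z W V : C) (r : Y ~> T V) (s : W ~> T V)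
    (h : Z ~> T (Y ⊕ W)) (g : X ~> T (Y ⊕ Z)) :
  kext [| r, s |] ∘ exception_kcomp h g = kext [| r, kext [| r, s |] ∘ h |] ∘ g.
Proof.
unfold exception_kcomp.
now rewrite kext_kext_copair, kext_eta_comp, copair_injl.
Qed.

Lemma is_solution_exception_kcomp_swap (X Y Z : C)
    (h : Z ~> T (Y ⊕ X)) (g : X ~> T (Y ⊕ Z)) (s : X ~> T Y) :
  is_solution (exception_kcomp h g) s ->
  is_solution (exception_kcomp g h) (kext [| eta T Y, s |] ∘ h).
Proof.
unfold is_solution; rewrite !kext_exception_kcomp.
now intros <-.
Qed.

Lemma unique_solution_exception_kcomp_swap (X Y Z : C)
    (h : Z ~> T (Y ⊕ X)) (g : X ~> T (Y ⊕ Z)) :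
  (exists! t : Z ~> T Y, is_solution (exception_kcomp g h) t) ->
  exists! s : X ~> T Y, is_solution (exception_kcomp h g) s.
Proof.
intros [t [t_sol t_unique]].
exists (kext [| eta T Y, t |] ∘ g); split.
- now apply is_solution_exception_kcomp_swap.
- intros s s_sol.
  rewrite (t_unique _ (is_solution_exception_kcomp_swap s_sol)).
  now rewrite <- kext_exception_kcomp, <- s_sol.
Qed.

End KleisliCopairing.

Section WeakGuardedness.

Variables (C : coprodCategory) (I : idealized_monad C).

Lemma guarded_imor_comp (X Y Z : C) (h : X ~> imodule I (Y ⊕ Z)) :
  guarded (I := I) (imor I (Y ⊕ Z) ∘ h).
Proof.
exists (injr Y (imodule I (Y ⊕ Z)) ∘ h).
now rewrite compA, copair_injr.
Qed.

Lemma weakly_guarded_eta_compl_inj (Y Z : C) (sigma : summand Z Y) :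
  weakly_guarded (I := I) sigma (eta I Y ∘ compl_inj sigma).
Proof.
exists (eta I _ ∘ injl (compl sigma) (imodule I Y)).
now rewrite kext_eta_comp, copair_injl.
Qed.

Lemma weakly_guarded_imor_comp (X Y Z : C) (sigma : summand Z Y)
    (h : X ~> imodule I Y) :
  weakly_guarded sigma (imor I Y ∘ h).
Proof.
exists (eta I _ ∘ (injr (compl sigma) (imodule I Y) ∘ h)).
now rewrite kext_eta_comp, compA, copair_injr.
Qed.

Lemma weakly_guarded_kext_comp (X Y Z W : C) (sigma : summand Z Y)
    (k : W ~> I Y) (f : X ~> I W) :
  weakly_guarded sigma k -> weakly_guarded sigma (kext k ∘ f).
Proof.
intros [k' ->]; exists (kext k' ∘ f).
now rewrite compA, kext_comp.
Qed.

Lemma weakly_guarded_copair (X Y Z Z' : C) (sigma : summand Z' Z)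
    (f : X ~> I Z) (g : Y ~> I Z) :
  weakly_guarded sigma f -> weakly_guarded sigma g ->
  weakly_guarded sigma [| f, g |].
Proof.
intros [f' ->] [g' ->]; exists [| f', g' |].
now rewrite comp_copair.
Qed.

Lemma weakly_guarded_kext_copair (X Y Z V V' : C) (sigma : summand V' V)
    (f : X ~> I (Y ⊕ Z)) (g : Y ~> I V) (h : Z ~> I V) :
  weakly_guarded (inr_summand Y Z) f -> weakly_guarded sigma g ->
  weakly_guarded sigma (kext [| g, h |] ∘ f).
Proof.
intros [f' ->] g_guarded.
change (weakly_guarded sigma
  (kext [| g, h |] ∘ exception_kcomp (imor I (Y ⊕ Z)) f')).
rewrite kext_exception_kcomp, <- imor_mext.
apply weakly_guarded_kext_comp, weakly_guarded_copair.
- exact g_guarded.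
- apply weakly_guarded_imor_comp.
Qed.

Lemma abstract_guardedness_weakly_guarded :
  abstract_guardedness (T := I) (@weakly_guarded C I).
Proof.
split.
- intros X Y Z f; apply weakly_guarded_kext_comp.
  exact (weakly_guarded_eta_compl_inj (inr_summand Y Z)).
- exact weakly_guarded_copair.
- exact weakly_guarded_kext_copair.
Qed.

Lemma weakly_guarded_unique_solution (X Y : C) (f : X ~> I (Y ⊕ X)) :
  completely_iterative I -> weakly_guarded (inr_summand Y X) f ->
  exists! s : X ~> I Y, is_solution f s.
Proof.
intros I_iterative [g ->].
change (exists! s, is_solution (exception_kcomp (imor I (Y ⊕ X)) g) s).
apply unique_solution_exception_kcomp_swap, I_iterative.
unfold exception_kcomp; rewrite <- imor_mext.
apply guarded_imor_comp.
Qed.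

End WeakGuardedness.

Lemma weakly_guarded_ialpha_comp (C : coprodCategory) (I J : idealized_monad C)
    (ab : idealized_morphism I J) (X Y Z : C) (sigma : summand Z Y)
    (f : X ~> I Y) :
  weakly_guarded sigma f -> weakly_guarded sigma (ialpha ab Y ∘ f).
Proof.
intros [g ->].
rewrite compA, mmor_kext, <- compA, comp_copair.
rewrite (compA _ (eta I Y)), mmor_eta, ialpha_imor.
apply weakly_guarded_kext_comp, weakly_guarded_copair.
- apply weakly_guarded_eta_compl_inj.
- apply weakly_guarded_imor_comp.
Qed.

Theorem theorem3p17 (C : coprodCategory) (I : idealized_monad C) :
  abstract_guardedness (T := I) (@weakly_guarded C I) /\
  (completely_iterative I ->
     forall (X Y : C) (f : X ~> I (Y ⊕ X)),
       weakly_guarded (inr_summand Y X) f ->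
       exists! s : X ~> I Y, s = kext [| eta I Y, s |] ∘ f) /\
  (forall (J : idealized_monad C) (ab : idealized_morphism I J)
     (X Y Z : C) (sigma : summand Z Y) (f : X ~> I Y),
       weakly_guarded sigma f -> weakly_guarded sigma (ialpha ab Y ∘ f)).
Proof.
split; [ | split].
- apply abstract_guardedness_weakly_guarded.
- intros I_iterative X Y f; now apply weakly_guarded_unique_solution.
- intros J ab X Y Z sigma f; apply weakly_guarded_ialpha_comp.
Qed.
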